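(* Let $n$ be a positive integer and let $t_m=\frac{m(m+1)}{2}$ for every non-negative integer $m$. Then the set $$ A_n=\left\{(t_s,\ t_{r+1}-t_s-1) : 0\le s\le r\le n-2\right\} $$ is a generating index set of $\mathrm{ST}_{t_{n-1}}$.
   Context: For a non-negative integer $N$, let $T_N=\{(i,j)\in\mathbb{N}^2 : i+j<N\}$, where $\mathbb{N}$ is the set of non-negative integers. A binary Steinhaus triangle of size $N$ is a family $(a_{i,j})_{(i,j)\in T_N}$ of elements of $\mathbb{Z}_2=\{0,1\}$ such that $a_{i,j}\equiv a_{i-1,j}+a_{i-1,j+1}\pmod 2$ for all $(i,j)\in T_N$ with $i\ge1$. The set $\mathrm{ST}_N$ of binary Steinhaus triangles of size $N$ is a vector space over $\mathbb{Z}/2\mathbb{Z}$ (entrywise addition mod 2) of dimension $N$. A subset $A\subseteq T_N$ is a generating index set of $\mathrm{ST}_N$ if the linear map $\pi_A:\mathrm{ST}_N\to\mathbb{Z}_2^{|A|}$, $(a_{i,j})_{(i,j)\in T_N}\mapsto (a_{i,j})_{(i,j)\in A}$, is an isomorphism. *)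

(* Defs.v *)
From HB Require Import structures.
From mathcomp Require Import all_boot all_order all_algebra.
From mathcomp Require Import finmap.

Set Implicit Arguments.
Unset Strict Implicit.
Unset Printing Implicit Defensive.

Import GRing.Theory.

Local Open Scope fset_scope.

Definition triangle (N : nat) : {fset nat * nat} :=
  [fset ((i, j) : nat * nat) | i in iota 0 N, j in iota 0 N & i + j < N].

Lemma mem_triangle (N i j : nat) : ((i, j) \in triangle N) = (i + j < N).
Proof.
apply/imfset2P/idP => [[i' _ [j']] | lt_ijN].
  by rewrite !inE => /andP[_ ?] [-> ->].
have lt_iN : i < N by apply: leq_ltn_trans lt_ijN; apply: leq_addr.
have lt_jN : j < N by apply: leq_ltn_trans lt_ijN; apply: leq_addl.
exists i; first by rewrite /= mem_iota.
by exists j; rewrite // !inE mem_iota /= lt_jN.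
Qed.

(* The rule a_{i,j} = a_{i-1,j} + a_{i-1,j+1}, with (i, j), (i-1, j) and
   (i-1, j+1) given as elements u, v and w of the triangle: if (i, j) lies in
   the triangle and i >= 1, then so do the other two positions.
   The annotation ^o makes 'F_2 a module over itself. *)
Definition steinhaus (N : nat) : {pred {ffun triangle N -> ('F_2)^o}} :=
  fun a => [forall u, forall v, forall w,
    [&& (val u).1 == (val v).1.+1, (val u).2 == (val v).2,
        (val w).1 == (val v).1 & (val w).2 == (val v).2.+1]
    ==> (a u == a v + a w)%R].

Lemma steinhaus_submod_closed (N : nat) : submod_closed (@steinhaus N).
Proof.
split=> [|c a b /'forall_'forall_'forall_implyP Ha
           /'forall_'forall_'forall_implyP Hb];
  apply/'forall_'forall_'forall_implyP => u v w Huvw.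
  by rewrite !ffunE addr0.
rewrite !ffunE (eqP (Ha u v w Huvw)) (eqP (Hb u v w Huvw)).
by rewrite scalerDr addrACA.
Qed.

HB.instance Definition _ (N : nat) :=
  GRing.isSubmodClosed.Build 'F_2 {ffun triangle N -> ('F_2)^o} (@steinhaus N)
    (steinhaus_submod_closed N).

Record ST (N : nat) := SteinhausTriangle {
  ST_val :> {ffun triangle N -> ('F_2)^o};
  ST_valP : ST_val \in @steinhaus N
}.

HB.instance Definition _ (N : nat) := [isSub for @ST_val N].
HB.instance Definition _ (N : nat) := [Choice of ST N by <:].
HB.instance Definition _ (N : nat) :=
  [SubChoice_isSubLmodule of ST N by <:].

Definition ST_proj (N : nat) (A : {fset nat * nat}) (sAT : A `<=` triangle N)
    (a : ST N) : {ffun A -> ('F_2)^o} :=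
  [ffun x : A => ST_val a (fincl sAT x)].

Definition generating_index_set (N : nat) (A : {fset nat * nat}) : Prop :=
  exists sAT : A `<=` triangle N,
    linear (ST_proj sAT) /\ bijective (ST_proj sAT).

Definition t (m : nat) : nat := (m * m.+1) %/ 2.

(* The truncated subtractions are exact, as t s + 1 <= t r.+1 when s <= r. *)
Definition A_ (n : nat) : {fset nat * nat} :=
  [fset ((t s, t r.+1 - t s - 1) : nat * nat)
     | r in iota 0 n.-1, s in iota 0 r.+1].

Lemma mem_A_ (n : nat) (p : nat * nat) : 0 < n ->
  reflect (exists r s, [/\ s <= r, r.+2 <= n & p = (t s, t r.+1 - t s - 1)])
          (p \in A_ n).
Proof.
move=> n_gt0; apply: (iffP idP).
  case/imfset2P=> r /=; rewrite mem_iota /= => lt_r [s].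
  rewrite (mem_iota 0 r.+1) => lt_s ->.
  by exists r, s; split=> //; rewrite -(prednK n_gt0) ltnS.
case=> r [s [le_sr lt_rn ->]]; apply/imfset2P; exists r => /=.
  by rewrite mem_iota /= -ltnS (prednK n_gt0).
by exists s; rewrite // (mem_iota 0 r.+1).
Qed.

(* Main.v *)
(** A Steinhaus triangle is determined by its top row [x], and the rule gives
    [a_{i,j} = \sum_c 'C(i, c) x_{j+c}].  If the triangle vanishes on the index
    set, then [x] vanishes on [0, t_M) by induction on [M]: once [x_j = 0] for
    [j < t_{M-1}], the entries at [(t_s, t_M - 1 - t_s)], for [s < M], are
    [\sum_(c < M) 'C(t_s, c) x_{t_M-1-c}], and the matrix ['C(t_s, c)] is
    invertible mod 2.  Indeed, by Vandermonde its determinant over the integers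
    is [\prod_(i < j) (t_j - t_i) / \prod_j j! = \prod_j (2j-1)!!], which is
    odd.  So the projection is injective; surjectivity follows by counting. *)
Require Import Defs.
From mathcomp Require Import all_boot.
From mathcomp Require Import all_order all_algebra finmap zify.

Set Implicit Arguments.
Unset Strict Implicit.
Unset Printing Implicit Defensive.

Import GRing.Theory Num.Theory.

(** * Differences of triangular numbers *)

Lemma double_t m : (t m).*2 = m * m.+1.
Proof. by rewrite /t divn2 halfK oddM /= andbN subn0. Qed.

Lemma tS m : t m.+1 = t m + m.+1.
Proof. by have := double_t m; have := double_t m.+1; nia. Qed.

Lemma leq_t : {homo t : m n / m <= n}.
Proof.
by apply: homo_leq => // [|i]; [exact: leq_trans | rewrite tS leq_addr].
Qed.

(** The double factorial (2j-1)!!. *)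
Definition odd_fact j := \prod_(i < j) i.*2.+1.

Lemma fact_double j : (j.*2)`! = 2 ^ j * (j`! * odd_fact j).
Proof.
elim: j => [|j IHj]; first by rewrite /odd_fact big_ord0.
rewrite doubleS !factS IHj /odd_fact big_ord_recr /= expnS.
by rewrite -doubleS -!mul2n; lia.
Qed.

(** Since 2(t_j - t_i) = (j - i)(j + i + 1), the product times 2^j is j! * ((2j)!/j!) = (2j)!. *)
Lemma prod_t_sub j : \prod_(i < j) (t j - t i) = j`! * odd_fact j.
Proof.
apply/eqP; rewrite -(eqn_pmul2l (expn_gt0 2 j : 0 < 2 ^ j)) -fact_double.
have -> : 2 ^ j = \prod_(i < j) 2 by rewrite prod_nat_const card_ord.
rewrite -big_split /=.
rewrite (eq_bigr (fun i : 'I_j => (j - i) * (j + i.+1))); last first.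
  move=> i _; have := double_t j; have := double_t i; have := ltn_ord i.
  have := leq_t (ltnW (ltn_ord i)); nia.
rewrite big_split /= -ffact_prod ffactnn.
have -> : \prod_(i < j) (j + i.+1) = j.*2 ^_ j.
  rewrite ffact_prod (reindex_inj rev_ord_inj) /=; apply: eq_bigr => i _.
  by have := ltn_ord i; lia.
by rewrite mulnC -(@ffact_fact j.*2 j) -addnn ?leq_addr // addnK.
Qed.

(** * Binomial determinants over the integers and mod 2 *)

Section BinomialDeterminant.
Local Open Scope ring_scope.

Definition ffact_poly c : {poly int} := \prod_(k < c) ('X - k%:R%:P).

Lemma size_ffact_poly c : size (ffact_poly c) = c.+1.
Proof. by rewrite size_prod_XsubC -[index_enum _]enumT size_enum_ord. Qed.

Lemma horner_ffact_poly c m : (ffact_poly c).[m%:R] = (m ^_ c)%:R.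
Proof.
elim: c => [|c IHc]; first by rewrite /ffact_poly big_ord0 hornerC.
rewrite /ffact_poly big_ord_recr /= hornerM -/(ffact_poly c) IHc hornerXsubC.
(* For m < c the truncated m - c is not the integer difference, but both sides are 0. *)
rewrite ffactnSr natrM; case: (leqP c m) => [le_cm|lt_mc].
  by rewrite natrB.
by rewrite ffact_small ?mul0r.
Qed.

(** As c! 'C(y, c) is a monic polynomial of degree c in y, scaling row c by c! gives a unitriangular
    coefficient matrix [U] times a Vandermonde matrix [V]. *)
Lemma det_binomial M (y : 'I_M -> nat) :
  (\prod_(c < M) c`!%:R) * \det (\matrix_(c < M, s < M) 'C(y s, c)%:R)
  = \prod_(i < M) \prod_(j < M | (i < j)%N) ((y j)%:R - (y i)%:R) :> int.
Proof.
set B := \matrix_(c, s) _.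
pose D : 'M[int]_M := diag_mx (\row_c c`!%:R).
pose U : 'M[int]_M := \matrix_(c, k) (ffact_poly c)`_k.
pose V : 'M[int]_M := Vandermonde M (\row_s (y s)%:R).
have detU : \det U = 1.
  rewrite det_trig; last first.
    by apply/is_trig_mxP => c k lt_ck; rewrite mxE nth_default ?size_ffact_poly.
  apply: big1 => c _; rewrite mxE.
  have /monicP :=
    monic_prod_XsubC (index_enum 'I_c) predT (fun k => k%:R : int).
  by rewrite lead_coefE -/(ffact_poly c) size_ffact_poly.
have DB : D *m B = U *m V.
  apply/matrixP => c s; rewrite mul_diag_mx !mxE -natrM mulnC bin_ffact.
  rewrite -horner_ffact_poly (@horner_coef_wide _ M) ?size_ffact_poly //.
  by apply: eq_bigr => k _; rewrite !mxE.
have /(congr1 determinant) := DB.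
rewrite !det_mulmx detU mul1r det_diag det_Vandermonde => detDB.
transitivity (\prod_i (\row_c c`!%:R : 'rV[int]_M) 0 i * \det B).
  by congr (_ * _); apply: eq_bigr => c _; rewrite mxE.
by rewrite detDB; apply: eq_bigr => i _; apply: eq_bigr => j _; rewrite !mxE.
Qed.

Lemma det_binomial_t M :
  \det (\matrix_(c < M, s < M) 'C(t s, c)%:R)
  = \prod_(j < M) (odd_fact j)%:R :> int.
Proof.
have fact_neq0 : \prod_(c < M) c`!%:R != 0 :> int.
  by apply/prodf_neq0 => c _; rewrite pnatr_eq0 -lt0n fact_gt0.
apply: (mulfI fact_neq0); rewrite det_binomial -big_split /=.
(* With the larger index j outside, the factors i < j form the product of [prod_t_sub], and its j!
   cancels. *)
rewrite (exchange_big_dep xpredT) //=; apply: eq_bigr => j _.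
rewrite -natrM -prod_t_sub natr_prod.
rewrite (big_ord_widen _ (fun i => (t j - t i)%N%:R) (ltnW (ltn_ord j))).
by apply: eq_bigr => i lt_ij; rewrite natrB // leq_t // ltnW.
Qed.

Lemma binomial_t_unitmx M :
  (\matrix_(c < M, s < M) 'C(t s, c)%:R : 'M['F_2]_M) \in unitmx.
Proof.
rewrite unitmxE unitfE.
have -> : \matrix_(c < M, s < M) 'C(t s, c)%:R
    = map_mx intr (\matrix_(c < M, s < M) 'C(t s, c)%:R) :> 'M['F_2]_M.
  by apply/matrixP => c s; rewrite !mxE rmorph_nat.
rewrite det_map_mx det_binomial_t rmorph_prod; apply/prodf_neq0 => j _ /=.
rewrite rmorph_nat natr_prod; apply/prodf_neq0 => i _.
have two0 : 2%:R = 0 :> 'F_2 by apply: val_inj.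
by rewrite -(addn1 i.*2) natrD -muln2 natrM two0 mulr0 add0r oner_neq0.
Qed.

End BinomialDeterminant.

(** * Rows of a triangle in terms of the top row *)

Section Rows.
Local Open Scope ring_scope.
Variable V : nmodType.
Implicit Type x : nat -> V.

Definition next_row x j := x j + x j.+1.

Definition row_at x i := iter i next_row x.

Lemma row_atE x i j : row_at x i j = \sum_(c < i.+1) x (j + c)%N *+ 'C(i, c).
Proof.
elim: i j => [|i IHi] j; first by rewrite big_ord1 addn0.
rewrite /row_at iterS /next_row -/(row_at x i) !IHi.
rewrite [RHS]big_ord_recl !bin0 /=.
under [in RHS]eq_bigr => c _ do rewrite /bump /= add1n binS mulrnDr.
rewrite big_split /= addrA; congr (_ + _); last first.
  by apply: eq_bigr => c _; rewrite addnS.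
rewrite [in RHS]big_ord_recr /= bin_small // mulr0n addr0 big_ord_recl bin0.
by congr (_ + _); apply: eq_bigr => c _; rewrite /bump add1n.
Qed.

(** Symmetry of binomials lets the sum start at x_m and run down, so all entries on the antidiagonal
    m use the same x_{m-c}. *)
Lemma row_at_antidiag x i m : (i <= m)%N ->
  row_at x i (m - i) = \sum_(c < i.+1) x (m - c)%N *+ 'C(i, c).
Proof.
move=> le_im; rewrite row_atE (reindex_inj rev_ord_inj) /=.
apply: eq_bigr => c _; have le_ci : (c <= i)%N by rewrite -ltnS.
by rewrite subSS bin_sub //; congr (x _ *+ _); lia.
Qed.

End Rows.

Lemma row_vanish M (x : nat -> 'F_2) :
    (forall s k, s < k <= M -> row_at x (t s) (t k - 1 - t s) = 0%R) ->
  forall j, j < t M -> x j = 0%R.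
Proof.
elim: M => [|M IHM] x0 //.
have {IHM} x_low j : j < t M -> x j = 0%R.
  by apply: IHM => s k /andP[lt_sk le_kM]; rewrite x0 // lt_sk leqW.
(* The new block x_j, t_M <= j < t_{M+1}, in reverse order. *)
pose v : 'rV['F_2]_M.+1 := (\row_c x (t M.+1 - 1 - c)%N)%R.
have := binomial_t_unitmx M.+1; set B := (\matrix_(c, s) _)%R => unitB.
suff /(congr1 (mulmx^~ (invmx B))) : (v *m B = 0)%R.
  rewrite mulmxK // mul0mx => v0 j; rewrite tS => lt_j.
  have [/x_low //|ge_j] := ltnP j (t M).
  have lt_c : t M.+1 - 1 - j < M.+1 by rewrite tS; lia.
  move/rowP/(_ (Ordinal lt_c)): v0; rewrite !mxE /= => <-.
  by congr x; rewrite tS; lia.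
apply/rowP => s; rewrite !mxE.
have le_sM : s <= M by rewrite -ltnS.
have := leq_t le_sM => le_ts.
have := x0 s M.+1; rewrite ltn_ord leqnn => /(_ isT).
rewrite row_at_antidiag ?tS; last by lia.
move=> sum0; pose F c := (x (t M + M.+1 - 1 - c)%N *+ 'C(t s, c))%R.
transitivity (\sum_(c < M.+1) F c)%R.
  by apply: eq_bigr => c _; rewrite !mxE mulr_natr tS.
rewrite -[RHS]sum0 -/F.
(* Both sums are brought to a common range. Terms with c > t_s have a zero binomial; those with M <
   c <= t_s involve x below t_M, already zero. *)
rewrite (big_ord_widen (M.+1 + (t s).+1) F) ?leq_addr //.
rewrite (big_ord_widen (M.+1 + (t s).+1) F) ?leq_addl //.
rewrite big_mkcond [RHS]big_mkcond; apply: eq_bigr => c _.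
case: ifPn => cM; case: ifPn => ct //.
  by rewrite /F bin_small ?mulr0n // ltnNge -ltnS.
by rewrite /F x_low ?mul0rn //; lia.
Qed.

(** * Triangles, their top rows and the projection *)

Section Triangles.
Variable N : nat.
Local Open Scope fset_scope.

Definition idx i j (lt_ijN : i + j < N) : triangle N :=
  FSetSub (etrans (mem_triangle N i j) lt_ijN).

(** Extended by 0 past the triangle, so that [row_at] applies; entries inside never see the
    default. *)
Definition top_row (a : ST N) (j : nat) : 'F_2 :=
  if insub (0, j) is Some u then ST_val a u else 0%R.

Lemma top_row_at (a : ST N) i j (lt_ijN : i + j < N) :
  ST_val a (idx lt_ijN) = row_at (top_row a) i j.
Proof.
elim: i j lt_ijN => [|i IHi] j lt_ijN.
  rewrite /row_at /= /top_row; case: insubP => [u _ u_val|].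
    by congr (ST_val a _); apply: val_inj; rewrite u_val.
  by rewrite mem_triangle lt_ijN.
have lt1 : i + j < N by apply: ltnW.
have lt2 : i + j.+1 < N by rewrite addnS.
rewrite /row_at iterS /next_row -!/(row_at _ i) -IHi -IHi.
have /'forall_'forall_'forall_implyP st := ST_valP a.
by apply/eqP/st; rewrite /= !eqxx.
Qed.

Definition row_triangle (x : {ffun 'I_N -> 'F_2}) :
    {ffun triangle N -> ('F_2)^o} :=
  [ffun u => row_at (fun j => if insub j is Some k then x k else 0%R)
               (val u).1 (val u).2].

Lemma row_triangle_steinhaus x : row_triangle x \in @steinhaus N.
Proof.
apply/'forall_'forall_'forall_implyP => u v w.
by case/and4P=> /eqP u1 /eqP u2 /eqP w1 /eqP w2; rewrite !ffunE u1 u2 w1 w2.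
Qed.

Definition row_ST x : ST N := SteinhausTriangle (row_triangle_steinhaus x).

Lemma row_ST_inj : injective row_ST.
Proof.
move=> x y /(congr1 (@ST_val N)) /ffunP eq_xy; apply/ffunP => j.
by have := eq_xy (@idx 0 j (ltn_ord j)); rewrite !ffunE /row_at /= valK.
Qed.

Variables (A : {fset nat * nat}) (sAT : A `<=` triangle N).

Lemma ST_proj_linear : linear (ST_proj sAT).
Proof. by move=> c a b; apply/ffunP => u; rewrite !ffunE. Qed.

Lemma ST_proj_inj :
    (forall a : ST N, (forall u, ST_proj sAT a u = 0%R) ->
       forall j, j < N -> top_row a j = 0%R) ->
  injective (ST_proj sAT).
Proof.
move=> top0 a b eq_ab; apply/eqP; rewrite -GRing.subr_eq0; apply/eqP.
set d := (a - b)%R.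
have d_top : forall j, j < N -> top_row d j = 0%R.
  apply: top0 => u; have /ffunP/(_ u) := eq_ab; rewrite !ffunE => ->.
  exact: subrr.
apply: val_inj; apply/ffunP => -[[i j] ijN].
have lt_ijN : i + j < N by rewrite -mem_triangle.
have -> : [` ijN] = idx lt_ijN by apply: val_inj.
(* Entry (i, j) only involves x_{j+c} with c <= i, hence j + c < N. *)
rewrite [LHS]top_row_at row_atE big1 ?ffunE // => c _.
by rewrite d_top ?mul0rn //; have := ltn_ord c; lia.
Qed.

(** Precomposed with [row_ST], the projection is an injection from 2^N elements into 2^|A| <= 2^N,
    hence bijective. This gives a right inverse, two-sided by injectivity. *)
Lemma ST_proj_bij :
  #|` A| <= N -> injective (ST_proj sAT) -> bijective (ST_proj sAT).
Proof.
move=> leAN inj_p.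
have [h _ hK] : bijective (ST_proj sAT \o row_ST).
  apply: inj_card_bij; first exact: inj_comp row_ST_inj.
  by rewrite !card_ffun !card_ord -cardfE leq_pexp2l.
exists (row_ST \o h) => [a|b]; last exact: hK.
by apply: inj_p; apply: hK.
Qed.

End Triangles.

(** * The index set *)

Lemma A_subset n : 0 < n -> (A_ n `<=` triangle (t n.-1))%fset.
Proof.
move=> n_gt0; apply/fsubsetP => -[i j] /(mem_A_ _ n_gt0)[r [s [le_sr lt_rn]]].
case=> -> ->; rewrite mem_triangle.
have := leq_t le_sr; have : t r.+1 <= t n.-1 by apply: leq_t; lia.
by rewrite tS; lia.
Qed.

(** The pairs s <= r <= n-2 number 1 + ... + (n-1). *)
Lemma card_A_ n : (#|` A_ n| <= t n.-1)%N.
Proof.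
pose p r s := (t s, t r.+1 - t s - 1).
have sub : {subset A_ n <= [seq p r s | r <- iota 0 n.-1, s <- iota 0 r.+1]}.
  by move=> u /imfset2P[r r_in [s s_in ->]]; apply: allpairs_f_dep.
apply: leq_trans (uniq_leq_size (fset_uniq _) sub) _.
rewrite size_allpairs_dep; elim: n.-1 => // m IHm.
by rewrite -addn1 iotaD map_cat sumn_cat /= size_iota addn1 tS addn0 leq_add2r.
Qed.

Theorem theorem2 (n : nat) (hn : 0 < n) :
  generating_index_set (t n.-1) (A_ n).
Proof.
exists (A_subset hn); split; first exact: ST_proj_linear.
apply: (ST_proj_bij (card_A_ n)); apply: ST_proj_inj => a a0.
apply: row_vanish => s [//|r] /andP[le_sr le_rn].
have inA : (t s, t r.+1 - t s - 1) \in A_ n.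
  by apply/(mem_A_ _ hn); exists r, s; split=> //; lia.
have lt_N : t s + (t r.+1 - t s - 1) < t n.-1.
  by rewrite -mem_triangle; apply: (fsubsetP (A_subset hn)).
rewrite subnAC -(top_row_at a lt_N) -(a0 [` inA]%fset) ffunE.
by congr (ST_val a _); apply: val_inj.
Qed.
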